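(* Let $k\ge 1$ be an integer and let $c_+^k(n,\ell)$ be the number of $k$-compositions of $n$ with exactly $\ell$ positive parts. Then for all $n\ge 2$ and $\ell\ge 1$, $$c_+^k(n,\ell)=k\,c_+^k(n-1,\ell-1)+c_+^k(n-1,\ell),$$ and for all $n\ge 1$ and $\ell\ge 1$, $$c_+^k(n,\ell)=k^{\ell-1}\binom{n-1}{\ell-1}.$$
   Context: A composition of a positive integer $n$ is a finite ordered sequence of positive integers (parts) with sum $n$. For a positive integer $k$, a $k$-composition of $n$ is a composition of $n$ with either of the following equivalent modifications. (a) Colored parts: each part is assigned a color in $\{1,\dots,k\}$, except that the first part must have color 1. (b) Internal zeros: each (positive) part except the first may be immediately preceded by up to $k-1$ zeros. The two versions correspond by replacing each colored part $c_\ell$ with $\ell-1$ zeros followed by $c$; the number of positive parts is the same in both versions (in version (a) every part is positive). Put $c_+^k(n,0)=0$. *)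

(* Defs.v *)
From mathcomp Require Import all_boot.
Set Implicit Arguments.
Unset Strict Implicit.
Unset Printing Implicit Defensive.

(* A colored part is a pair (part, color), with colors numbered 1, ..., k as
   natural numbers.  The condition 0 < n records that only positive integers
   have compositions; it excludes the empty sequence, so that the count below
   is 0 for l = 0. *)
Definition is_kcomposition (k n : nat) (s : seq (nat * nat)) : bool :=
  [&& 0 < n,
      sumn (unzip1 s) == n,
      all (fun p => 0 < p.1) s,
      all (fun p => 1 <= p.2 <= k) s
    & (head (0, 1) s).2 == 1].

Definition part_of_ord (n k : nat) (p : 'I_n.+1 * 'I_k.+1) : nat * nat :=
  (val p.1, val p.2).

(* All parts of a sequence with l entries are positive, so l is the number of
   positive parts.  Parts are at most n and colors at most k, hence the finite
   type below loses nothing: see kcomposition_tuple. *)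
Definition num_kcompositions (k n l : nat) : nat :=
  #|[set t : l.-tuple ('I_n.+1 * 'I_k.+1)
      | is_kcomposition k n (map (@part_of_ord n k) t)]|.

Lemma part_of_ord_inj (n k : nat) : injective (@part_of_ord n k).
Proof. by move=> [a b] [c d] [/val_inj -> /val_inj ->]. Qed.

Lemma kcomposition_tuple (k n l : nat) (s : seq (nat * nat)) :
  is_kcomposition k n s -> size s = l ->
  exists! t : l.-tuple ('I_n.+1 * 'I_k.+1), map (@part_of_ord n k) t = s.
Proof.
case/and5P=> _ /eqP sum_s _ /allP col_s _ sz_s.
pose f (p : nat * nat) : 'I_n.+1 * 'I_k.+1 := (inord p.1, inord p.2).
have fK p : p \in s -> part_of_ord (f p) = p.
  move=> ps; rewrite /part_of_ord /= !inordK; first by case: p ps.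
    by case/andP: (col_s p ps).
  rewrite ltnS -sum_s; move: ps; elim: (s) => //= q r IH.
  rewrite inE => /orP[/eqP <-|/IH]; first exact: leq_addr.
  by move/leq_trans; apply; apply: leq_addl.
have szf : size (map f s) == l by rewrite size_map sz_s.
have mapK : map (@part_of_ord n k) (map f s) = s.
  by rewrite -map_comp -[RHS]map_id; apply/eq_in_map.
exists (Tuple szf); split=> // t' t's.
apply/val_inj/(inj_map (@part_of_ord_inj n k)).
by rewrite t's.
Qed.

(* Main.v *)
Require Import Defs.
From mathcomp Require Import all_boot zify.

(** Both claims rest on one bijection, obtained by taking one unit away from
    the first part of a [k]-composition of [n >= 2].
    - If the first part is at least 2, it decreases by one; this is reversible
      and leaves a [k]-composition of [n - 1] with as many parts.
    - If the first part is 1, it disappears.  The next part, which exists since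
      [n >= 2], becomes the first one and must be given color 1.  The color it
      had is lost, so each [k]-composition of [n - 1] with one part fewer
      arises exactly [k] times.
    The recurrence follows ([num_kcompositions_rec]).  The closed form is then
    Pascal's rule, by induction on [n].

    The finite type over which [num_kcompositions] counts depends on [n], which
    is awkward for a bijection between different values of [n].  The counted
    objects are therefore first listed as plain sequences ([kcompositions]);
    the bijection becomes a permutation of duplicate-free lists
    ([kcompositions_rec]). *)

Definition kcompositions (k n l : nat) : seq (seq (nat * nat)) :=
  [seq map (@part_of_ord n k) t | t : l.-tuple ('I_n.+1 * 'I_k.+1) in
     [set t : l.-tuple ('I_n.+1 * 'I_k.+1)
        | is_kcomposition k n (map (@part_of_ord n k) t)]].

Lemma size_kcompositions k n l :
  size (kcompositions k n l) = num_kcompositions k n l.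
Proof. by rewrite size_image. Qed.

Lemma kcompositions_uniq k n l : uniq (kcompositions k n l).
Proof.
rewrite map_inj_uniq ?enum_uniq // => t u /(inj_map (@part_of_ord_inj n k)).
exact: val_inj.
Qed.

Lemma mem_kcompositions k n l s :
  (s \in kcompositions k n l) = is_kcomposition k n s && (size s == l).
Proof.
apply/imageP/andP => [[t] | [comp_s /eqP size_s]].
  by rewrite inE => comp_t ->; rewrite size_map size_tuple.
have [t [def_s _]] := kcomposition_tuple comp_s size_s.
by exists t; rewrite ?inE def_s.
Qed.

Lemma is_kcomposition_cons k n c a t : 0 < k ->
  is_kcomposition k n ((c, a) :: t) =
    [&& c + sumn (unzip1 t) == n, 0 < c, a == 1,
        all (fun p => 0 < p.1) t & all (fun p => 1 <= p.2 <= k) t].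
Proof.
move=> k_gt0; rewrite /is_kcomposition /=.
case: (a =P 1) => [->|_]; last by rewrite !andbF.
rewrite k_gt0 andbT /= -!andbA andbCA; case: eqP => //= sum_n.
by case: c sum_n => [|c] /= sum_n; rewrite ?andbF // -sum_n.
Qed.

Lemma is_kcomposition_nil k n : is_kcomposition k n [::] = false.
Proof. by case: n. Qed.

Definition grow_head (s : seq (nat * nat)) : seq (nat * nat) :=
  if s is (c, a) :: t then (c.+1, a) :: t else [::].

Lemma grow_head_inj : injective grow_head.
Proof. by move=> [|[c a] t] [|[d b] u] //= [-> -> ->]. Qed.

Definition color_head (j : nat) (s : seq (nat * nat)) : seq (nat * nat) :=
  if s is (c, _) :: t then (c, j) :: t else [::].

Definition cons_unit (j : nat) (s : seq (nat * nat)) : seq (nat * nat) :=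
  (1, 1) :: color_head j s.

(** The color overwritten by [cons_unit] is no loss: the first part of a
    [k]-composition has color 1. *)
Lemma cons_unit_uniq k n l (js : seq nat) : 0 < k -> uniq js ->
  uniq [seq cons_unit j s | j <- js, s <- kcompositions k n l].
Proof.
move=> k_gt0 uniq_js; apply: allpairs_uniq uniq_js (kcompositions_uniq k n l) _.
move=> _ _ /allpairsP[[i s] [_ s_in ->]] /allpairsP[[j u] [_ u_in ->]] /=.
move: s_in u_in; rewrite /= !mem_kcompositions.
case: s u => [|[c a] s] [|[d b] u]; rewrite ?is_kcomposition_nil //.
rewrite !is_kcomposition_cons //.
case/andP=> /and5P[_ _ /eqP-> _ _] _ /andP[/and5P[_ _ /eqP-> _ _] _].
by case=> -> -> ->.
Qed.

(** The bijection itself: the first part is either at least 2, hence grown from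
    a smaller one, or a unit put before a part of arbitrary color. *)
Lemma kcompositions_rec k n l : 0 < k ->
  perm_eq (kcompositions k n.+2 l.+1)
    (map grow_head (kcompositions k n.+1 l.+1) ++
     [seq cons_unit j s | j <- iota 1 k, s <- kcompositions k n.+1 l]).
Proof.
move=> k_gt0; apply: uniq_perm; first exact: kcompositions_uniq.
  rewrite cat_uniq (map_inj_uniq grow_head_inj) kcompositions_uniq.
  rewrite cons_unit_uniq ?iota_uniq // andbT /=.
  (* A grown first part has value at least 2, whereas [cons_unit] puts a 1. *)
  apply/hasPn => _ /allpairsP[[j s] [_ _ ->]]; apply/mapP => -[[|[c a] t]] //.
  rewrite mem_kcompositions is_kcomposition_cons // => /andP[].
  by move=> /and5P[_ c_gt0 _ _ _] _ [c0]; rewrite -c0 in c_gt0.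
move=> s; rewrite mem_cat mem_kcompositions; apply/idP/orP.
- case: s => [|[c a] t]; first by rewrite is_kcomposition_nil.
  rewrite is_kcomposition_cons //.
  case/andP=> /and5P[sum_n c_gt0 /eqP-> pos_t col_t] /= size_t.
  case: c c_gt0 sum_n => [|[|c]] // _ sum_n; [right | left].
    case: t pos_t col_t size_t sum_n => [|[d j] t] //=.
    move=> /andP[d_gt0 pos_t] /andP[j_col col_t] size_t sum_n.
    apply/allpairsP; exists (j, (d, 1) :: t); split=> //=.
      by rewrite mem_iota add1n ltnS.
    rewrite mem_kcompositions is_kcomposition_cons // d_gt0 pos_t col_t.
    by move: sum_n; rewrite add1n eqSS => ->.
  apply/mapP; exists ((c.+1, 1) :: t) => //.
  rewrite mem_kcompositions is_kcomposition_cons // pos_t col_t size_t.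
  by move: sum_n; rewrite addSn eqSS => ->.
case=> [/mapP[[|[c a] t]] | /allpairsP[[j [|[c a] t]] [/= j_in]]];
  rewrite mem_kcompositions ?is_kcomposition_nil //.
  rewrite is_kcomposition_cons // => /andP[/and5P[sum_n _ a1 pos_t col_t] sz].
  move=> ->; rewrite is_kcomposition_cons // addSn eqSS sum_n a1 pos_t col_t.
  by rewrite sz.
rewrite is_kcomposition_cons // => /andP[/and5P[sum_n c_gt0 _ pos_t col_t] sz].
move=> ->; rewrite is_kcomposition_cons //= add1n !eqSS sum_n c_gt0 pos_t col_t.
by move: j_in; rewrite mem_iota add1n ltnS => ->; rewrite -(eqP sz) /= eqxx.
Qed.

Lemma num_kcompositions_rec k n l : 0 < k ->
  num_kcompositions k n.+2 l.+1 =
    k * num_kcompositions k n.+1 l + num_kcompositions k n.+1 l.+1.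
Proof.
move=> k_gt0; rewrite -!size_kcompositions.
rewrite (perm_size (kcompositions_rec k n l k_gt0)).
by rewrite size_cat size_map size_allpairs size_iota addnC.
Qed.

Lemma num_kcompositions0 k n : num_kcompositions k n 0 = 0.
Proof.
rewrite -size_kcompositions; case def_s: (kcompositions k n 0) => [|s ss] //.
have: s \in kcompositions k n 0 by rewrite def_s mem_head.
rewrite mem_kcompositions => /andP[+ /nilP s0].
by rewrite s0 is_kcomposition_nil.
Qed.

Lemma num_kcompositions1 k l : 0 < k ->
  num_kcompositions k 1 l.+1 = (l == 0).
Proof.
move=> k_gt0; rewrite -size_kcompositions.
suff /perm_size->: perm_eq (kcompositions k 1 l.+1) (nseq (l == 0) [:: (1, 1)]).
  by rewrite size_nseq.
apply: uniq_perm; [exact: kcompositions_uniq | by case: l |].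
move=> [|[c a] t]; rewrite mem_kcompositions mem_nseq.
  by rewrite is_kcomposition_nil [RHS]andbF.
rewrite is_kcomposition_cons //= !eqSS; case: t => [|[d b] t] /=.
  by rewrite eqseq_cons xpair_eqE; case: l c a => [|l] [|[|c]] [|[|a]].
(* A second part would be positive and bring the sum above 1. *)
rewrite eqseq_cons !andbF; apply/negP => /andP[/and5P[/eqP sum1 c_gt0 _]].
by case/andP=> d_gt0; lia.
Qed.

(** Multiplying Pascal's rule by [k ^ l] gives the recurrence of
    [num_kcompositions_rec]. *)
Lemma num_kcompositionsE k n l : 0 < k ->
  num_kcompositions k n.+1 l.+1 = k ^ l * 'C(n, l).
Proof.
move=> k_gt0; elim: n l => [|n IHn] [|l].
- by rewrite num_kcompositions1.
- by rewrite num_kcompositions1 // bin0n muln0.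
- by rewrite num_kcompositions_rec // num_kcompositions0 IHn muln0 !bin0.
by rewrite num_kcompositions_rec // !IHn binS mulnDr mulnA -expnS addnC.
Qed.

Theorem proposition5 (k : nat) (hk : 1 <= k) :
  (forall n l : nat, 2 <= n -> 1 <= l ->
     num_kcompositions k n l =
       k * num_kcompositions k (n - 1) (l - 1) + num_kcompositions k (n - 1) l)
  /\
  (forall n l : nat, 1 <= n -> 1 <= l ->
     num_kcompositions k n l = k ^ (l - 1) * 'C(n - 1, l - 1)).
Proof.
split=> [[|[|n]] [|l] // _ _ | [|n] [|l] // _ _]; rewrite !subn1 /=.
  exact: num_kcompositions_rec.
exact: num_kcompositionsE.
Qed.
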